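(* Let $k \ge 1$ be an integer. There exists an algebraic representation $\mathbf{A} = (A, F)$ of the lattice $N_k$ such that $A$ has $k+3$ elements and $F$ consists of $2k+2$ functions.
   Context: An algebraic structure is a pair $\mathbf{A} = (A, F)$ where $A$ is a set and $F$ is a set of functions (operations), each of the form $f : A^m \to A$ for some $m \in \mathbb{N} \cup \{0\}$ (the arity $m$ may depend on $f$; a nullary operation, $m=0$, is a distinguished constant in $A$). A subalgebra of $\mathbf{A}$ is a subset $B \subseteq A$ closed under every operation in $F$ (in particular containing every nullary constant), with the restricted operations. The subalgebras of $\mathbf{A}$, ordered by set inclusion, form a lattice $\mathbf{Sub}(\mathbf{A})$. An algebraic representation of a lattice $L$ is an algebraic structure $\mathbf{A}$ such that $\mathbf{Sub}(\mathbf{A})$ is isomorphic to $L$ as a lattice. The lattice $N_k$ has $k+3$ elements: a least element $0$, a greatest element $1$, a chain of $k$ elements $0 < b_1 < \dots < b_k < 1$, and an element $a$ (with $0 < a < 1$) that is incomparable to every $b_i$, $i \in \{1, \dots, k\}$. *)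

(* Defs.v *)
From HB Require Import structures.
From mathcomp Require Import all_boot all_order.
From mathcomp Require Import boolp classical_sets functions cardinality.

Set Implicit Arguments.
Unset Strict Implicit.
Unset Printing Implicit Defensive.

Import Order.TTheory.
Local Open Scope classical_set_scope.

(* Two operations are equal iff they have the same arity and the same graph,
   so that cardinalities of sets of operations count distinct functions. *)
Definition operation (A : Type) : Type := {m : nat & m.-tuple A -> A}.

Definition arity (A : Type) (f : operation A) : nat := projT1 f.

Definition apply_op (A : Type) (f : operation A) : (arity f).-tuple A -> A :=
  projT2 f.
Arguments apply_op {A} f x.

Record algebra := Algebra {
  carrier : Type;
  operations : set (operation carrier)
}.
Arguments operations : clear implicits.

(* For f of arity 0 the premise on x is vacuous: B contains the constant f.
   The empty set is allowed when there is no nullary operation. *)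
Definition is_subalgebra (A : algebra) (B : set (carrier A)) : Prop :=
  forall f : operation (carrier A), operations A f ->
  forall x : (arity f).-tuple (carrier A),
    (forall i : 'I_(arity f), B (tnth x i)) -> B (apply_op f x).
Arguments is_subalgebra : clear implicits.

Record Sub (A : algebra) := MkSub {
  sub_set :> set (carrier A);
  sub_setP : `[< is_subalgebra A sub_set >]
}.

HB.instance Definition _ (A : algebra) := [isSub for @sub_set A].
HB.instance Definition _ (A : algebra) := [Choice of Sub A by <:].
HB.instance Definition _ (A : algebra) :=
  [SubChoice_isSubPOrder of Sub A by <: with set_display].

Lemma le_SubE (A : algebra) (B C : Sub A) :
  (B <= C)%O = `[< (B : set (carrier A)) `<=` C >].
Proof. by []. Qed.

Section SubLattice.
Variable A : algebra.
Implicit Types B C D : Sub A.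

Lemma sub_meet_subproof B C : `[< is_subalgebra A (B `&` C) >].
Proof.
apply/asboolP => f Ff x xBC; split.
- by apply: (asboolW (sub_setP B)) Ff _ _ => i; case: (xBC i).
- by apply: (asboolW (sub_setP C)) Ff _ _ => i; case: (xBC i).
Qed.

Definition sub_meet B C : Sub A := MkSub (sub_meet_subproof B C).

Lemma sub_join_subproof B C :
  `[< is_subalgebra A (smallest (is_subalgebra A) (B `|` C)) >].
Proof.
apply/asboolP => f Ff x xBC D [subD BCD].
by apply: (subD f Ff) => i; exact: (xBC i D (conj subD BCD)).
Qed.

Definition sub_join B C : Sub A := MkSub (sub_join_subproof B C).

Lemma sub_meetP B C D : (B <= sub_meet C D)%O = (B <= C)%O && (B <= D)%O.
Proof.
rewrite !le_SubE; apply/asboolP/andP => [BCD|[/asboolP BC /asboolP BD]].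
  by split; apply/asboolP => x /BCD[].
by move=> x Bx; split; [apply: BC|apply: BD].
Qed.

Lemma sub_joinP B C D : (sub_join B C <= D)%O = (B <= D)%O && (C <= D)%O.
Proof.
rewrite !le_SubE; apply/asboolP/andP => [BCD|[/asboolP BD /asboolP CD]].
  by split; apply/asboolP => x Bx; apply: BCD => E [_]; apply; [left|right].
move=> x; apply; split; first exact: asboolW (sub_setP D).
by move=> y [/BD|/CD].
Qed.

HB.instance Definition _ := Order.POrder_MeetJoin_isLattice.Build
  set_display (Sub A) sub_meetP sub_joinP.

End SubLattice.

Definition lattice_isomorphic (d d' : Order.disp_t)
    (L : latticeType d) (M : latticeType d') : Prop :=
  exists f : {lmorphism L -> M}, bijective f.

Definition algebraic_representation (d : Order.disp_t)
    (A : algebra) (L : latticeType d) : Prop :=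
  lattice_isomorphic (Sub A) L.

(* The index of Nb starts at 0: Nb i is the element b_{i+1} of the chain. *)
Inductive N (k : nat) : Type := N0 | N1 | Na | Nb of 'I_k.
Arguments N0 {k}.
Arguments N1 {k}.
Arguments Na {k}.

Section NLattice.
Variable k : nat.
Implicit Types x y z : N k.

Definition N_encode x : 'I_3 + 'I_k :=
  match x with
  | N0 => inl (inord 0) | N1 => inl (inord 1) | Na => inl (inord 2)
  | Nb i => inr i
  end.

Definition N_decode (s : 'I_3 + 'I_k) : N k :=
  match s with
  | inl i => if val i == 0 then N0 else if val i == 1 then N1 else Na
  | inr i => Nb i
  end.

Lemma N_encodeK : cancel N_encode N_decode.
Proof. by case=> //=; rewrite inordK. Qed.

HB.instance Definition _ := Countable.copy (N k) (can_type N_encodeK).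
HB.instance Definition _ : isFinite (N k) := CanIsFinite N_encodeK.

Definition N_le x y : bool :=
  match x, y with
  | N0, _ => true
  | _, N1 => true
  | Na, Na => true
  | Nb i, Nb j => i <= j
  | _, _ => false
  end.

Lemma N_le_refl : reflexive N_le.
Proof. by case=> //= i; exact: leqnn. Qed.

Lemma N_le_anti : antisymmetric N_le.
Proof.
by case=> [|||i] [|||j] //= /anti_leq ij; congr Nb; apply: val_inj.
Qed.

Lemma N_le_trans : transitive N_le.
Proof. by case=> [|||i] [|||j] [|||l] //=; exact: leq_trans. Qed.

Fact N_display : Order.disp_t. Proof. by []. Qed.

HB.instance Definition _ := Order.Le_isPOrder.Build
  N_display (N k) N_le_refl N_le_anti N_le_trans.

Definition N_meet x y : N k :=
  match x, y with
  | N1, z | z, N1 => z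
  | Na, Na => Na
  | Nb i, Nb j => if i <= j then Nb i else Nb j
  | _, _ => N0
  end.

Definition N_join x y : N k :=
  match x, y with
  | N0, z | z, N0 => z
  | Na, Na => Na
  | Nb i, Nb j => if i <= j then Nb j else Nb i
  | _, _ => N1
  end.

Lemma N_meetP x y z : (x <= N_meet y z)%O = (x <= y)%O && (x <= z)%O.
Proof.
rewrite /Order.le /=.
case: x y z => [|||i] [|||j] [|||l] //=; rewrite ?andbT ?andbF //;
  case: (leqP j l) => //= jl; apply/idP/andP => [|[]] //.
- by move=> ij; rewrite ij (leq_trans ij).
- by move=> il; rewrite il (leq_trans il) // ltnW.
Qed.

Lemma N_joinP x y z : (N_join x y <= z)%O = (x <= z)%O && (y <= z)%O.
Proof.
rewrite /Order.le /=.
case: x y z => [|||i] [|||j] [|||l] //=; rewrite ?andbT ?andbF //;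
  case: (leqP i j) => //= ij; apply/idP/andP => [|[]] //.
- by move=> jl; rewrite jl (leq_trans ij).
- by move=> il; rewrite il (leq_trans (ltnW ij)).
Qed.

HB.instance Definition _ := Order.POrder_MeetJoin_isLattice.Build
  N_display (N k) N_meetP N_joinP.

Lemma card_N : #|{: N k}| = k + 3.
Proof.
rewrite -[RHS]addnC -[in RHS](card_ord 3) -[X in _ + X]card_ord -card_sum.
apply: bij_eq_card; exists N_decode; first exact: N_encodeK.
case=> [[[|[|[|//]]] i3]|i] //=; congr inl; apply: val_inj;
  by rewrite /= inordK.
Qed.

End NLattice.

(* Main.v *)
Require Import Defs.
From HB Require Import structures.
From mathcomp Require Import all_boot all_order.
From mathcomp Require Import boolp classical_sets functions cardinality.
Local Open Scope classical_set_scope.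
Local Open Scope card_scope.

(** A finite lattice L is isomorphic to the lattice of its ideals, since every
    ideal is the principal ideal of its largest element.  It is therefore
    enough to put on the set N k operations whose closed subsets are exactly
    the ideals: then the carrier has k + 3 elements for free
    ([represents_of_ideals], [ideal_principal]).

    Closure under the constant 0 and the binary join makes a closed set
    nonempty and directed.  What remains is to force closure downwards by 2k
    unary operations, each of which satisfies f x <= x, so that ideals stay
    closed.  The k maps x |-> x /\ b_i bring every element above b_i down
    to b_i; the only relation they leave out is a <= 1, which is supplied by
    k variants of these maps that send 1 to a instead of b_i.  For k >= 1 at
    least one variant exists, and the values at the b_j and at 1 tell the 2k
    maps apart, giving 2k + 2 operations in all. *)

Import Order.TTheory.

Lemma eq_lower (d : Order.disp_t) (L : porderType d) (x y : L) :
  (forall z, (z <= x)%O = (z <= y)%O) -> x = y.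
Proof.
by move=> xy; apply/le_anti; have := xy y; have := xy x; rewrite !lexx => <- ->.
Qed.

Lemma eq_upper (d : Order.disp_t) (L : porderType d) (x y : L) :
  (forall z, (x <= z)%O = (y <= z)%O) -> x = y.
Proof.
by move=> xy; apply/le_anti; have := xy y; have := xy x; rewrite !lexx => <- ->.
Qed.

(** Sending a subalgebra to its largest element is inverse to taking principal
    ideals, and both maps are monotone.  Meets and joins are determined by
    their lower, respectively upper, bounds, so they are preserved. *)
Lemma represents_of_ideals (d : Order.disp_t) (L : latticeType d)
    (F : set (operation L)) :
  (forall B : set L, is_subalgebra (Algebra F) B <->
     exists c : L, B = [set x | (x <= c)%O]) ->
  algebraic_representation (Algebra F) L.
Proof.
move=> FP; set S := Defs.Sub (Algebra F).
have /choice[g gE] (c : L) :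
    exists B : S, (B : set L) = [set x | (x <= c)%O].
  have Bc : `[< is_subalgebra (Algebra F) [set x | (x <= c)%O] >].
    by apply/asboolP/FP; exists c.
  by exists (MkSub Bc).
have /choice[f fE] (B : S) :
    exists c : L, (B : set L) = [set x | (x <= c)%O].
  by apply/FP; exact: asboolW (Defs.sub_setP B).
have gK : cancel f g by move=> B; apply: val_inj; rewrite /= gE -fE.
have le_g c (B : S) : (g c <= B)%O = (c <= f B)%O.
  rewrite le_SubE gE [in LHS]fE; apply/asboolP/idP => [|cB x xc].
    by apply; exact: lexx.
  exact: le_trans xc cB.
have fK : cancel g f.
  move=> c; apply: eq_lower => z; apply/idP/idP;
    by have /(congr1 (@^~ z)) := fE (g c); rewrite gE /= => ->.
have ge_f (B : S) c : (f B <= c)%O = (B <= g c)%O.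
  by rewrite -{1}[c]fK -le_g gK.
have f_mono : {homo f : B C / (B <= C)%O} by move=> B C; rewrite ge_f gK.
pose f_homo := Order.isOrderMorphism.Build _ _ _ _ f f_mono.
have fI : Order.meet_morphism f.
  by move=> B C; apply: eq_lower => c; rewrite lexI -!le_g lexI.
have fU : Order.join_morphism f.
  by move=> B C; apply: eq_upper => c; rewrite leUx !ge_f leUx.
pose f_meet := Order.isMeetLatticeMorphism.Build _ _ _ _ f fI.
pose f_join := Order.isJoinLatticeMorphism.Build _ _ _ _ f fU.
pose fL : {lmorphism S -> L} := HB.pack f f_homo f_meet f_join.
by exists fL; exists g.
Qed.

(** The generator is the join of all elements of the ideal, which lies in the
    ideal because L is finite. *)
Lemma ideal_principal (d : Order.disp_t) (L : finTBLatticeType d)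
    (B : set L) :
    B \bot%O -> (forall x y, B x -> B y -> B (x `|` y)%O) ->
    (forall x y, (x <= y)%O -> B y -> B x) ->
  exists c : L, B = [set x | (x <= c)%O].
Proof.
move=> B0 BU Ble; exists (\join_(x | `[< B x >]) x)%O.
apply/seteqP; split=> x /= => [Bx|/Ble]; first exact/joins_sup/asboolP.
by apply; apply: big_ind => // y /asboolP.
Qed.

Lemma card_finType (T : finType) : [set: T] #= `I_#|T|.
Proof.
have rank_inj : injective (val \o @enum_rank T).
  exact: inj_comp val_inj enum_rank_inj.
apply: card_eq_trans (_ : range (val \o @enum_rank T) #= _).
  by rewrite card_eq_sym; apply: inj_card_eq => x y _ _; exact: rank_inj.
suff -> : range (val \o @enum_rank T) = `I_#|T| by exact: card_eqxx.
apply/seteqP; split=> [_ [x _ <-]|i /= iT]; first exact: ltn_ord.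
by exists (enum_val (Ordinal iT)); rewrite //= enum_valK.
Qed.

Section Operations.
Variable k : nat.

Lemma N0_le (x : N k) : (N0 <= x)%O. Proof. by []. Qed.
Lemma le_N1 (x : N k) : (x <= N1)%O. Proof. by case: x. Qed.

HB.instance Definition _ := Order.hasBottom.Build N_display (N k) N0_le.
HB.instance Definition _ := Order.hasTop.Build N_display (N k) le_N1.

Definition cut (to_a : bool) (i : 'I_k) (x : N k) : N k :=
  if to_a && (x == N1) then Na else (x `&` Nb i)%O.

Lemma cut_le to_a i x : (cut to_a i x <= x)%O.
Proof. by rewrite /cut; case: andP => [[_ /eqP->]|_] //; exact: leIl. Qed.

Definition op_N (s : bool + bool * 'I_k) : operation (N k) :=
  match s with
  | inl false => existT _ 0 (fun=> N0)
  | inl true => existT _ 2 (fun x => (tnth x ord0 `|` tnth x ord_max)%O)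
  | inr (to_a, i) => existT _ 1 (fun x => cut to_a i (tnth x ord0))
  end.

Definition algebra_N := Algebra (range op_N).

Lemma op_N_inj : injective op_N.
Proof.
pose diag (f : operation (N k)) x := apply_op f [tuple of nseq (arity f) x].
have diagE t i x : diag (op_N (inr (t, i))) x = cut t i x.
  by rewrite /diag /= (tnth_nth N0).
case=> [b|[t i]] [c|[u j]] eq_st; have := congr1 (@arity _) eq_st.
- by case: b c {eq_st} => [] [].
- by case: b {eq_st}.
- by case: c {eq_st}.
move=> _; have cutE x : cut t i x = cut u j x by rewrite -!diagE eq_st.
(* At 1 the maps x /\ b_i take values in the chain, their variants do not. *)
have tu : t = u.
  by have := cutE N1; rewrite /cut eqxx !andbT; case: (t) (u) => [] [].
have le_ij : (Nb i <= Nb j)%O.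
  have := cutE (Nb i); rewrite /cut !andbF meetxx => ->; exact: leIr.
have le_ji : (Nb j <= Nb i)%O.
  have := cutE (Nb j); rewrite /cut !andbF meetxx => <-; exact: leIr.
have [ij] : Nb i = Nb j by apply/le_anti/andP.
by rewrite tu ij.
Qed.

(** Every operation is bounded by the join of its arguments, hence preserves
    ideals. *)
Lemma subalgebra_ideal (c : N k) :
  is_subalgebra algebra_N [set x | (x <= c)%O].
Proof.
move=> _ [[[]|[t i]] _ <-] x /= xc //; first by rewrite leUx !xc.
exact: le_trans (cut_le _ _ _) (xc ord0).
Qed.

Section Subalgebra.
Variable B : set (N k).
Hypothesis subB : is_subalgebra algebra_N B.

Lemma subalgebra_N0 : B N0.
Proof.
by apply: (@subB (op_N (inl false)) _ [tuple]); [exists (inl false)|case].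
Qed.

Lemma subalgebra_join x y : B x -> B y -> B (x `|` y)%O.
Proof.
move=> Bx By; apply: (@subB (op_N (inl true)) _ [tuple x; y]).
  by exists (inl true).
by case=> [[|[|//]] ?]; rewrite (tnth_nth x).
Qed.

Lemma subalgebra_cut to_a i x : B x -> B (cut to_a i x).
Proof.
move=> Bx; apply: (@subB (op_N (inr (to_a, i))) _ [tuple x]).
  by exists (inr (to_a, i)).
by move=> j; rewrite (tnth_nth x) ord1.
Qed.

Lemma subalgebra_down (k_gt0 : 0 < k) x y : (x <= y)%O -> B y -> B x.
Proof.
case: x => [|||i] xy By.
- exact: subalgebra_N0.
- by case: y xy By.
- (* Only a and 1 lie above a. *)
  case: y xy By => // _ B1.
  by have := subalgebra_cut true (Ordinal k_gt0) _ B1; rewrite /cut eqxx.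
- by have := subalgebra_cut false i _ By; rewrite /cut /= meet_r.
Qed.

End Subalgebra.

Lemma algebra_N_represents (k_gt0 : 0 < k) :
  algebraic_representation algebra_N (N k).
Proof.
apply: represents_of_ideals => B; split=> [subB|[c ->]]; last first.
  exact: subalgebra_ideal.
apply: ideal_principal.
- exact: subalgebra_N0.
- exact: subalgebra_join.
- exact: subalgebra_down.
Qed.

End Operations.

Theorem proposition2 (k : nat) (k_ge1 : 1 <= k) :
  exists A : algebra,
    [/\ algebraic_representation A (N k),
        [set: carrier A] #= `I_(k + 3)
      & operations A #= `I_(2 * k + 2)].
Proof.
exists (algebra_N k); split; first exact: algebra_N_represents.
- by rewrite -card_N; exact: card_finType.
- have -> : 2 * k + 2 = #|{: bool + bool * 'I_k}|.
    by rewrite card_sum card_prod card_bool card_ord addnC.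
  apply: card_eq_trans (card_finType _).
  by apply: inj_card_eq => x y _ _; exact: op_N_inj.
Qed.
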